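(* Let $f:[0,\infty)\to\mathbb{R}$ be a continuous superquadratic function. Let $A,B,C,D$ be positive bounded linear operators on a Hilbert space $\mathcal{H}$ such that $A+D=B+C$ and $$0\leq A\leq mI\leq B\leq C\leq MI\leq D$$ for some positive scalars $m<M$. If $\Phi$ is a unital positive linear map on $\mathcal{B}(\mathcal{H})$, then $$f(\Phi(B))+f(\Phi(C))+\beta(\Phi(B))+\beta(\Phi(C))\leq\Phi(f(A))+\Phi(f(D))-\Phi(f(mI-A))-\Phi(f(D-MI))+\frac{f(M-m)}{M-m}\Big(\Phi(A-D)+(M-m)I\Big).$$
   Context: A function $f:[0,\infty)\to\mathbb{R}$ is called superquadratic if for every $x\geq 0$ there exists a constant $C_x\in\mathbb{R}$ such that $f(y)\geq f(x)+C_x(y-x)+f(|y-x|)$ for all $y\geq 0$. For given $m<M$ and $f$, the function $\beta$ is defined by $$\beta(t)=\frac{t-m}{M-m}f(M-t)+\frac{M-t}{M-m}f(t-m),\qquad t\in[m,M].$$ $\mathcal{B}(\mathcal{H})$ is the algebra of all bounded linear operators on the Hilbert space $\mathcal{H}$ and $I$ is the identity operator. An operator $A\in\mathcal{B}(\mathcal{H})$ is positive if $\langle A\eta,\eta\rangle\geq 0$ for every $\eta\in\mathcal{H}$; for self-adjoint $X,Y$, $X\leq Y$ means that $Y-X$ is positive. For a self-adjoint operator $X$ and a function $g$ continuous on an interval containing the spectrum of $X$, $g(X)$ is defined by the continuous functional calculus. A linear map $\Phi:\mathcal{B}(\mathcal{H})\to\mathcal{B}(\mathcal{H})$ is positive if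 it maps positive operators to positive operators, and unital if $\Phi(I)=I$. *)

(* Defs.v *)
From HB Require Import structures.
From mathcomp Require Import all_boot all_order all_algebra.
From mathcomp Require Import sesquilinear complex.
From mathcomp Require Import all_classical all_reals all_analysis.

Set Implicit Arguments.
Unset Strict Implicit.
Unset Printing Implicit Defensive.

Import Order.TTheory GRing.Theory Num.Theory.
Import numFieldNormedType.Exports.

Local Open Scope classical_set_scope.
Local Open Scope complex_scope.
Local Open Scope ring_scope.

(* Complex Hilbert spaces: the inner product is linear in its first argument,
   and the norm of a normed module over R[i] takes its values in R[i]. *)
HB.mixin Record hasInnerProduct (R : realType) H
    of CompleteNormedModule R[i] H := {
  inner : {dot H for (@Num.conj R[i])} ;
  inner_norm : forall x : H, inner x x = `|x| ^+ 2
}.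

#[short(type="hilbertType")]
HB.structure Definition Hilbert (R : realType) :=
  { H of CompleteNormedModule R[i] H & hasInnerProduct R H }.

Section BoundedOperators.
Context {R : realType} {H : hilbertType R}.

Definition bounded_linear : {pred H -> H} := [pred T : H -> H |
  `[< linear T /\ exists k : R[i], forall x, `|T x| <= k * `|x| >]].

Lemma bounded_linearP (T : H -> H) :
  reflect (linear T /\ exists k : R[i], forall x, `|T x| <= k * `|x|)
    (T \in bounded_linear).
Proof. exact: asboolP. Qed.

Lemma bounded_linear_submod : submod_closed bounded_linear.
Proof.
split.
  apply/bounded_linearP; split=> [a x y|]; first by rewrite /= scaler0 addr0.
  by exists 0 => x; rewrite mul0r normr0.
move=> a S T /bounded_linearP[lS [k Sk]] /bounded_linearP[lT [l Tl]].
apply/bounded_linearP; split=> [b x y|].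
  rewrite !fctE lS lT !scalerDr !scalerA (mulrC a b) -!addrA; congr (_ + _).
  by rewrite addrCA.
exists (`|a| * k + l) => x; rewrite mulrDl -mulrA !fctE.
by rewrite (le_trans (ler_normD _ _))// lerD// normrZ ler_wpM2l.
Qed.

HB.instance Definition _ :=
  GRing.isSubmodClosed.Build R[i] (H -> H) bounded_linear bounded_linear_submod.

End BoundedOperators.

Record boundedOp (R : realType) (H : hilbertType R) := BoundedOp {
  boundedOp_fun :> H -> H ;
  boundedOp_subproof : boundedOp_fun \in bounded_linear
}.

HB.instance Definition _ (R : realType) (H : hilbertType R) :=
  [isSub for @boundedOp_fun R H].
HB.instance Definition _ (R : realType) (H : hilbertType R) :=
  [Choice of boundedOp H by <:].
HB.instance Definition _ (R : realType) (H : hilbertType R) :=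
  [SubChoice_isSubLmodule of boundedOp H by <:].

Notation "''B' ( H )" := (boundedOp H) (format "''B' ( H )") : type_scope.

Section OperatorAlgebra.
Context {R : realType} {H : hilbertType R}.
Implicit Types S T U : 'B(H).

Lemma boundedOp_linear T : linear T.
Proof. by case: T => T /= /bounded_linearP[]. Qed.

HB.instance Definition _ T :=
  GRing.isLinear.Build R[i] H H *:%R T (boundedOp_linear T).

Lemma boundedOpP S T : S =1 T -> S = T.
Proof. by move=> ST; apply/val_inj/funext. Qed.

Lemma id_bounded_linear : @id H \in bounded_linear.
Proof. by apply/bounded_linearP; split=> //; exists 1 => x; rewrite mul1r. Qed.

Lemma comp_bounded_linear S T : S \o T \in bounded_linear.
Proof.
apply/bounded_linearP; split=> [a x y|]; first by rewrite /= !linearP.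
have /bounded_linearP[_ [k Sk]] := boundedOp_subproof S.
have /bounded_linearP[_ [l Tl]] := boundedOp_subproof T.
exists (`|k| * l) => x /=; rewrite (le_trans (Sk _))//.
have [->|y0] := eqVneq (T x) 0.
  by rewrite normr0 mulr0 -mulrA mulr_ge0// (le_trans _ (Tl x)).
have k0 : 0 <= k.
  by rewrite -(pmulr_lge0 _ (_ : 0 < `|T x|)) ?normr_gt0// (le_trans _ (Sk _)).
by rewrite -mulrA (ger0_norm k0) ler_wpM2l.
Qed.

Definition op_one : 'B(H) := BoundedOp id_bounded_linear.
Definition op_mul S T : 'B(H) := BoundedOp (comp_bounded_linear S T).

Fact op_mulA : associative op_mul. Proof. by move=> S T U; exact: boundedOpP. Qed.
Fact op_mul1l : left_id op_one op_mul. Proof. by move=> T; exact: boundedOpP. Qed.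
Fact op_mul1r : right_id op_one op_mul. Proof. by move=> T; exact: boundedOpP. Qed.
Fact op_mulDl : left_distributive op_mul +%R.
Proof. by move=> S T U; exact: boundedOpP. Qed.
Fact op_mulDr : right_distributive op_mul +%R.
Proof. by move=> S T U; apply: boundedOpP => x; exact: linearD. Qed.

HB.instance Definition _ := GRing.Zmodule_isPzRing.Build 'B(H)
  op_mulA op_mul1l op_mul1r op_mulDl op_mulDr.

Definition scalar_op (a : R[i]) : 'B(H) := a *: (1 : 'B(H)).

(* In R[i], [0 <= z] means that z is real and nonnegative. *)
Definition op_pos T := forall x : H, 0 <= inner (T x) x.

Definition op_le S T := op_pos (T - S).

Definition opnorm T : R :=
  inf [set k : R | 0 <= k /\ forall x, `|T x| <= k%:C * `|x|].

Definition spectrum T : set R[i] :=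
  [set l | ~ exists S : 'B(H), (T - scalar_op l) * S = 1 /\ S * (T - scalar_op l) = 1].

(* p(T); 'B(H) is no algType, since H may be trivial. *)
Definition op_horner (p : {poly R}) T : 'B(H) :=
  \sum_(i < size p) (p`_i)%:C *: T ^+ i.

(* g(T) for a self-adjoint T, whose spectrum is real: the limit in operator
   norm of p_n(T) for real polynomials p_n that converge to g uniformly on the
   spectrum of T. *)
Definition is_cfc (g : R -> R) T S := exists p : nat -> {poly R},
  {uniform [set t : R | spectrum T t%:C],
    (fun n t => (p n).[t]) @ \oo --> g} /\
  opnorm (op_horner (p n) T - S) @[n --> \oo] --> (0 : R).

Definition cfc (g : R -> R) T : 'B(H) := xget 0 [set S | is_cfc g T S].

End OperatorAlgebra.

Notation "S <=o T" := (op_le S T) (at level 70, no associativity) : ring_scope.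

(* Functions on [0, +oo[ are given by total functions; their values at negative
   arguments are irrelevant. *)
Definition superquadratic (R : realType) (f : R -> R) :=
  forall x, 0 <= x -> exists C : R, forall y, 0 <= y ->
    f y >= f x + C * (y - x) + f `|y - x|.

Definition beta (R : realType) (f : R -> R) (m M t : R) : R :=
  (t - m) / (M - m) * f (M - t) + (M - t) / (M - m) * f (t - m).

(* Main.v *)
Require Import Defs.
From mathcomp Require Import all_boot all_order all_algebra.
From mathcomp Require Import complex ring lra.
From mathcomp Require Import all_classical all_reals all_analysis.

(** Let L be the chord of f through m and M, and k = f (M - m) / (M - m).
    Averaging the superquadratic inequality over two points, with weights that
    make its unknown slope cancel, gives three scalar estimates:
      f t + beta t <= L t                           for m <= t <= M,
      L s + k (m - s) <= f s - f (m - s)            for 0 <= s <= m,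
      L s + k (s - M) <= f s - f (s - M)            for M <= s
    ([superquadratic_inside], [superquadratic_left], [superquadratic_right]).
    The functional calculus turns them into operator inequalities: the first
    for Phi B and Phi C, which lie between m and M because Phi is positive and
    unital, the second for A and the third for D. Applying Phi to the last two
    and adding, everything reduces to L (Phi A) + L (Phi D) = L (Phi B) +
    L (Phi C), which holds because L is affine and A + D = B + C.

    Two facts about the functional calculus are used: g(T) exists, and g <= q
    on the spectrum of T implies g(T) <= q(T) for a polynomial q. Both rest on
    [op_horner_ge0]: a real polynomial that is nonnegative on the spectrum of a
    symmetric T is nonnegative at T. The bottom mu of the numerical range of a
    symmetric operator S belongs to its spectrum ([negative_spectrum]), so if
    r(T) is not positive then r(T) - mu is not invertible for some mu < 0;
    splitting r - mu into complex linear factors ([op_horner_invertible]), r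
    takes the value mu at a point of the spectrum of T. Invertibility is always
    obtained from a Neumann series ([op_ge_invertible]): a symmetric operator
    bounded below by a positive constant is invertible.
    Existence of g(T) then follows from the Weierstrass theorem
    ([weierstrass]), the norm bound [rnorm_horner_le], which is positivity of
    e^2 - q^2, and completeness of the operator algebra ([op_complete]). *)

Import Order.TTheory GRing.Theory Num.Theory.
Import numFieldNormedType.Exports.

Local Open Scope classical_set_scope.
Local Open Scope complex_scope.
Local Open Scope ring_scope.

Set Implicit Arguments.
Unset Strict Implicit.

(** * The real inner product and symmetric operators *)

Section RealInnerProduct.
Context {R : realType} {H : hilbertType R}.
Implicit Types (x y z : H) (a : R).

(** The real part of the inner product, a real inner product on H. For a complex
    linear operator, symmetry with respect to it is self-adjointness, so that
    all the estimates below can be made between real numbers. *)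
Definition rdot x y : R := complex.Re (inner x y).
Definition rnorm x : R := complex.Re `|x|.

Lemma innerDl x y z : inner (x + y) z = inner x z + inner y z.
Proof. exact: linearDl. Qed.

Lemma innerZl (c : R[i]) x z : inner (c *: x) z = c * inner x z.
Proof. exact: linearZl_LR. Qed.

Lemma innerC x y : inner x y = (inner y x)^*%C.
Proof.
by have := @hermC _ _ _ _ (@inner R H) x y; rewrite expr0 mul1r.
Qed.

Lemma ReD (u v : R[i]) : complex.Re (u + v) = complex.Re u + complex.Re v.
Proof. by case: u v => ? ? []. Qed.

Lemma ReZ a (u : R[i]) : complex.Re (a%:C * u) = a * complex.Re u.
Proof. by case: u => b c /=; rewrite mul0r subr0. Qed.

Lemma rdotC x y : rdot x y = rdot y x.
Proof. by rewrite /rdot innerC; case: (inner y x). Qed.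

Lemma rdotDl x y z : rdot (x + y) z = rdot x z + rdot y z.
Proof. by rewrite /rdot innerDl ReD. Qed.

Lemma rdotZl a x z : rdot (a%:C *: x) z = a * rdot x z.
Proof. by rewrite /rdot innerZl ReZ. Qed.

Lemma rdotDr x y z : rdot z (x + y) = rdot z x + rdot z y.
Proof. by rewrite rdotC rdotDl !(rdotC z). Qed.

Lemma rdotZr a x z : rdot z (a%:C *: x) = a * rdot z x.
Proof. by rewrite rdotC rdotZl (rdotC z). Qed.

Lemma rdotNl x z : rdot (- x) z = - rdot x z.
Proof.
by rewrite -scaleN1r -(rmorph1 (real_complex R)) -rmorphN rdotZl mulN1r.
Qed.

Lemma rdotNr x z : rdot z (- x) = - rdot z x.
Proof. by rewrite rdotC rdotNl (rdotC z). Qed.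

Lemma rdotBl x y z : rdot (x - y) z = rdot x z - rdot y z.
Proof. by rewrite rdotDl rdotNl. Qed.

Lemma rdotBr x y z : rdot z (x - y) = rdot z x - rdot z y.
Proof. by rewrite rdotDr rdotNr. Qed.

Lemma rdot0l z : rdot 0 z = 0.
Proof. by rewrite -(subrr z) rdotBl subrr. Qed.

Lemma rdot0r z : rdot z 0 = 0.
Proof. by rewrite rdotC rdot0l. Qed.

Definition rdotE := (rdotDl, rdotDr, rdotBl, rdotBr, rdotNl, rdotNr,
  rdotZl, rdotZr, rdot0l, rdot0r).

Lemma rnormE x : `|x| = (rnorm x)%:C.
Proof. by rewrite /rnorm RRe_real// normr_real. Qed.

Lemma rnorm_ge0 x : 0 <= rnorm x.
Proof. by rewrite -ler0c -rnormE. Qed.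

Lemma rdotxx x : rdot x x = rnorm x ^+ 2.
Proof. by rewrite /rdot inner_norm rnormE -rmorphXn. Qed.

Lemma rdot_ge0 x : 0 <= rdot x x.
Proof. by rewrite rdotxx sqr_ge0. Qed.

Lemma rdot_eq0 x : (rdot x x == 0) = (x == 0).
Proof.
rewrite rdotxx sqrf_eq0 -(inj_eq (@complexI R)) -rnormE.
exact: normr_eq0.
Qed.

Lemma rdot_gt0 x : (0 < rdot x x) = (x != 0).
Proof. by rewrite lt_def rdot_eq0 rdot_ge0 andbT. Qed.

Lemma rnormD x y : rnorm (x + y) <= rnorm x + rnorm y.
Proof. by rewrite -lecR rmorphD /= -!rnormE ler_normD. Qed.

Lemma rnormZ a x : rnorm (a%:C *: x) = `|a| * rnorm x.
Proof.
apply: complexI; rewrite rmorphM /= -!rnormE normrZ; congr (_ * _).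
by rewrite normc_def /= expr0n /= addr0 sqrtr_sqr.
Qed.

Lemma rnormN x : rnorm (- x) = rnorm x.
Proof. by rewrite /rnorm normrN. Qed.

Lemma rnormB x y : rnorm (x - y) = rnorm (y - x).
Proof. by rewrite -opprB rnormN. Qed.

Lemma rnorm_eq0 x : (rnorm x == 0) = (x == 0).
Proof. by rewrite -rdot_eq0 rdotxx sqrf_eq0. Qed.

Lemma rnorm_le0 x : rnorm x <= 0 -> x = 0.
Proof. by move=> x0; apply/eqP; rewrite -rnorm_eq0 eq_le x0 rnorm_ge0. Qed.

Lemma rnorm_leP a x y : 0 <= a ->
  (rnorm x <= a * rnorm y) = (rdot x x <= a ^+ 2 * rdot y y).
Proof.
move=> a0; rewrite !rdotxx -exprMn ler_sqr// nnegrE ?rnorm_ge0//.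
by rewrite mulr_ge0// rnorm_ge0.
Qed.

Lemma CauchySchwarz_rdot x y : `|rdot x y| <= rnorm x * rnorm y.
Proof.
suff h u v : rdot u v <= rnorm u * rnorm v.
  by rewrite ler_norml lerNl -rdotNl -{1}(rnormN x) !h.
have [->|u0] := eqVneq u 0; first by rewrite rdot0l mulr_ge0 ?rnorm_ge0.
have [->|v0] := eqVneq v 0; first by rewrite rdot0r mulr_ge0 ?rnorm_ge0.
have nu : 0 < rnorm u by rewrite lt_def rnorm_eq0 u0 rnorm_ge0.
have nv : 0 < rnorm v by rewrite lt_def rnorm_eq0 v0 rnorm_ge0.
have := rdot_ge0 ((rnorm v)%:C *: u - (rnorm u)%:C *: v).
rewrite !rdotE !rdotxx (rdotC v u) => h.
have : rnorm u * rnorm v * rdot u v <= rnorm u * rnorm v * (rnorm u * rnorm v).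
  lra.
by rewrite ler_pM2l ?mulr_gt0.
Qed.

End RealInnerProduct.

Section SymmetricOperators.
Context {R : realType} {H : hilbertType R}.
Implicit Types (S T P : 'B(H)) (x y : H) (a : R).

Definition op_sym T := forall x y, rdot (T x) y = rdot x (T y).

Lemma op_linD T x y : T (x + y) = T x + T y. Proof. exact: linearD. Qed.
Lemma op_linB T x y : T (x - y) = T x - T y. Proof. exact: linearB. Qed.
Lemma op_linZ T (c : R[i]) x : T (c *: x) = c *: T x. Proof. exact: linearZ. Qed.
Lemma op_addE S T x : (S + T) x = S x + T x. Proof. by []. Qed.
Lemma op_oppE T x : (- T) x = - T x. Proof. by []. Qed.
Lemma op_scaleE (c : R[i]) T x : (c *: T) x = c *: T x. Proof. by []. Qed.
Lemma op_mulE S T x : (S * T) x = S (T x). Proof. by []. Qed.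
Lemma op_1E x : (1 : 'B(H)) x = x. Proof. by []. Qed.
Lemma op_0E x : (0 : 'B(H)) x = 0. Proof. by []. Qed.
Lemma scalar_opE (c : R[i]) x : scalar_op c x = c *: x. Proof. by []. Qed.

Definition opE :=
  (op_addE, op_oppE, op_scaleE, op_mulE, op_1E, op_0E, scalar_opE).

Lemma rdotiE x y : rdot x ('i%C *: y) = complex.Im (inner x y).
Proof.
rewrite /rdot innerC innerZl (innerC x y); case: (inner y x) => a b /=.
by rewrite mul0r mul1r sub0r.
Qed.

Lemma ImC x y : complex.Im (inner x y) = - complex.Im (inner y x).
Proof. by rewrite innerC; case: (inner y x). Qed.

(** On a complex Hilbert space positivity contains self-adjointness: the form of
    T is real at x + i y, and this is the polarization identity. *)
Lemma op_posP T :
  op_pos T <-> op_sym T /\ forall x, 0 <= rdot (T x) x.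
Proof.
split=> [T0|[sT T0] x].
  have rT x : complex.Im (inner (T x) x) = 0 by rewrite ger0_Im.
  split=> [x y|x]; last by have := T0 x; rewrite lecE => /andP[].
  have := rT (x + 'i%C *: y); rewrite -rdotiE !op_linD !op_linZ scalerDr.
  rewrite scalerA -expr2 sqr_i scaleN1r !rdotE !rdotiE rT.
  rewrite (rdotC x) /rdot !innerZl; have := rT y.
  by case: (inner (T y) y) (inner (T y) x) => [a b] [c d] /=; lra.
rewrite lecE -/(rdot (T x) x) T0 andbT; apply/eqP => /=.
have := rdotiE (T x) x; rewrite sT op_linZ rdotiE ImC; lra.
Qed.

Lemma op_sym1 : op_sym 1. Proof. by []. Qed.

Lemma op_symD S T : op_sym S -> op_sym T -> op_sym (S + T).
Proof. by move=> sS sT x y; rewrite !opE !rdotE sS sT. Qed.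

Lemma op_symZ a T : op_sym T -> op_sym (a%:C *: T).
Proof. by move=> sT x y; rewrite !opE !rdotE sT. Qed.

Lemma op_symN T : op_sym T -> op_sym (- T).
Proof. by move=> sT x y; rewrite !opE !rdotE sT. Qed.

Lemma op_symB S T : op_sym S -> op_sym T -> op_sym (S - T).
Proof. by move=> sS sT; apply: op_symD => //; exact: op_symN. Qed.

Lemma op_sym_scalar a : op_sym (scalar_op a%:C).
Proof. exact/op_symZ/op_sym1. Qed.

Lemma op_symX T n : op_sym T -> op_sym (T ^+ n).
Proof.
move=> sT; elim: n => [|n IH] x y; first by rewrite !expr0.
by rewrite {1}exprS exprSr !opE sT IH.
Qed.

Lemma op_leP S T : op_sym S -> op_sym T ->
  S <=o T <-> forall x, rdot (S x) x <= rdot (T x) x.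
Proof.
move=> sS sT; rewrite /op_le op_posP; split=> [[_ h] x|h].
  by have := h x; rewrite !opE !rdotE subr_ge0.
by split=> [|x]; [exact: op_symB|rewrite !opE !rdotE subr_ge0].
Qed.

Lemma rnorm_op_bound T :
  exists2 K : R, 0 < K & forall x, rnorm (T x) <= K * rnorm x.
Proof.
have /bounded_linearP[_ [k Tk]] := boundedOp_subproof T.
exists (`|complex.Re k| + 1) => [|x]; first by rewrite ltr_wpDl.
have := Tk x; rewrite !rnormE => /le_trans; have := rnorm_ge0 x.
move: (rnorm x) (rnorm (T x)) => u v u0 h.
have : v <= complex.Re k * u.
  have := h _ (lexx _); rewrite lecE => /andP[_ /=].
  by case: (k) => a b /=; rewrite mulr0 subr0.
have := ler_norm (complex.Re k); nra.
Qed.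

Lemma rdot_op_bound T K : (forall x, rnorm (T x) <= K * rnorm x) ->
  forall x, `|rdot (T x) x| <= K * rdot x x.
Proof.
move=> TK x; apply: le_trans (CauchySchwarz_rdot _ _) _.
by rewrite rdotxx expr2 mulrA ler_wpM2r ?rnorm_ge0.
Qed.

(** Positivity of P at K x - P x turns the bound P <= K on the form into a bound
    on the norm. In particular P x is small wherever the form of P is. *)
Lemma pos_rnorm_le P K : op_sym P -> 0 < K ->
  (forall x, 0 <= rdot (P x) x <= K * rdot x x) ->
  forall x, rdot (P x) (P x) <= K * rdot (P x) x.
Proof.
move=> sP K0 hP x.
have /andP[+ _] := hP (K%:C *: x - P x).
have /andP[_ ] := hP (P x).
rewrite !op_linB !op_linZ !rdotE (sP (P x) x) => h1 h2.
have : K * (rdot (P x) (P x)) <= K * (K * rdot (P x) x) by lra.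
by rewrite ler_pM2l.
Qed.

End SymmetricOperators.

(** * Completeness and invertibility *)

Section Completeness.
Context {R : realType} {H : hilbertType R}.
Implicit Types (S T P : 'B(H)) (x y : H).

Lemma rnorm_small x : (forall e : R, 0 < e -> rnorm x <= e) -> x = 0.
Proof.
by move=> h; apply: rnorm_le0; apply/ler_addgt0Pr => e e0; rewrite add0r h.
Qed.

Lemma rnorm_cauchy_cvg (u : nat -> H) :
  (forall e : R, 0 < e -> exists N, forall n k, (N <= n)%N -> (N <= k)%N ->
    rnorm (u n - u k) <= e) ->
  exists l, forall e : R, 0 < e -> exists N, forall n, (N <= n)%N ->
    rnorm (u n - l) <= e.
Proof.
move=> cu; have pos (e : R[i]) : 0 < e -> exists2 a : R, 0 < a & e = a%:C.
  by case: e => a b; rewrite ltcE /= => /andP[/eqP -> a0]; exists a.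
have : cvg (u @ \oo).
  apply: (cauchy_cvg (u @ \oo)); apply: cauchy_exP => e /pos[a a0 ->].
  have [|N hN] := cu (a / 2); first by rewrite divr_gt0.
  exists (u N); exists N => // n /= Nn.
  rewrite -ball_normE /= rnormE ltcR (le_lt_trans (hN _ _ _ _))// ltr_pdivrMr//.
  by rewrite ltr_pMr// ltr1n.
move=> /cvg_ex[l /cvgrPdist_le ul]; exists l => e e0.
have [|N _ hN] := ul e%:C; first by rewrite ltcR.
by exists N => n /hN /=; rewrite rnormE lecR rnormB.
Qed.

(** A sequence that is Cauchy for the operator norm converges pointwise, and the
    pointwise limit is again linear, bounded, and a limit in operator norm. *)
Lemma op_complete (T : nat -> 'B(H)) :
  (forall e : R, 0 < e -> exists N, forall n k, (N <= n)%N -> (N <= k)%N ->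
    forall x, rnorm (T n x - T k x) <= e * rnorm x) ->
  exists S, forall e : R, 0 < e -> exists N, forall n, (N <= n)%N ->
    forall x, rnorm (T n x - S x) <= e * rnorm x.
Proof.
move=> cT.
have /choice[S hS] x : exists l, forall e : R, 0 < e -> exists N, forall n,
    (N <= n)%N -> rnorm (T n x - l) <= e.
  apply: rnorm_cauchy_cvg => e e0.
  have d0 : 0 < e / (1 + rnorm x) by rewrite divr_gt0// ltr_pwDl// rnorm_ge0.
  have [N hN] := cT _ d0; exists N => n k Nn Nk; apply: le_trans (hN _ _ Nn Nk x) _.
  rewrite mulrAC ler_pdivrMr ?ltr_pwDl ?rnorm_ge0//.
  by rewrite ler_wpM2l ?(ltW e0)// lerDr.
have TS e : 0 < e -> exists N, forall n, (N <= n)%N ->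
    forall x, rnorm (T n x - S x) <= e * rnorm x.
  move=> e0; have [N hN] := cT _ e0; exists N => n Nn x.
  apply/ler_addgt0Pr => d d0; have [N' hN'] := hS x d d0.
  have -> : T n x - S x = (T n x - T (maxn N N') x) + (T (maxn N N') x - S x).
    by rewrite addrA subrK.
  apply: le_trans (rnormD _ _) _; rewrite lerD//.
    by rewrite hN// leq_maxl.
  by rewrite hN'// leq_maxr.
suff SB : S \in bounded_linear by exists (BoundedOp SB).
apply/bounded_linearP; split=> [c x y|].
  apply/eqP; rewrite -subr_eq0; apply/eqP/rnorm_small => e e0.
  have [K K0 cK] : exists2 K : R, 0 < K & forall z : H, rnorm (c *: z) <= K * rnorm z.
    have [k k0 ck] : exists2 k : R, 0 <= k & `|c| = k%:C.
      by exists (complex.Re `|c|); rewrite -?ler0c RRe_real ?normr_real.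
    exists (k + 1) => [|z]; first by rewrite ltr_wpDl.
    by rewrite -lecR rmorphM /= -!rnormE normrZ ck ler_wpM2r// lecR lerDl.
  have d0 : 0 < e / (K + 2) by rewrite divr_gt0// addr_gt0.
  have [N1 h1] := hS (c *: x + y) _ d0.
  have [N2 h2] := hS x _ d0.
  have [N3 h3] := hS y _ d0.
  pose n := maxn N1 (maxn N2 N3).
  have {}h1 := h1 n (leq_maxl _ _).
  have {}h2 : rnorm (T n x - S x) <= e / (K + 2).
    by apply: h2; rewrite /n maxnCA leq_maxl.
  have {}h3 : rnorm (T n y - S y) <= e / (K + 2).
    by apply: h3; rewrite /n maxnA leq_maxr.
  have -> : S (c *: x + y) - (c *: S x + S y)
      = - (T n (c *: x + y) - S (c *: x + y)) +
        (c *: (T n x - S x) + (T n y - S y)).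
    rewrite op_linD op_linZ opprB scalerBr.
    by rewrite [in RHS](addrACA (c *: T n x)) -opprD addrA subrK.
  apply: le_trans (rnormD _ _) _; rewrite rnormN.
  have := rnormD (c *: (T n x - S x)) (T n y - S y).
  have := cK (T n x - S x).
  have -> : e = e / (K + 2) * (K + 2) by rewrite divfK// gt_eqF// addr_gt0.
  nra.
have [N /(_ N (leqnn N)) hN] := TS 1 ltr01.
have [K K0 TK] := rnorm_op_bound (T N).
exists (K + 1)%:C => x; rewrite !rnormE -rmorphM lecR.
have -> : S x = T N x - (T N x - S x) by rewrite opprB addrC subrK.
by apply: le_trans (rnormD _ _) _; rewrite rnormN mulrDl lerD// hN.
Qed.

Definition op_invertible T := exists S, T * S = 1 /\ S * T = 1.

Lemma op_invertible1 : op_invertible 1.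
Proof. by exists 1; rewrite mulr1. Qed.

Lemma op_invertibleM S T :
  op_invertible S -> op_invertible T -> op_invertible (S * T).
Proof.
move=> [S' [SS' S'S]] [T' [TT' T'T]]; exists (T' * S'); split.
  by rewrite mulrA -(mulrA S) TT' mulr1.
by rewrite mulrA -(mulrA T') S'S mulr1.
Qed.

Lemma op_invertible_comm S T :
  S * T = T * S -> op_invertible (S * T) -> op_invertible S.
Proof.
move=> ST [U [STU UST]]; exists (T * U); rewrite mulrA; split=> //.
have e : T * U = U * T.
  by rewrite -[LHS]mul1r -UST ST -!mulrA (mulrA S) STU mulr1.
by rewrite e -mulrA -ST.
Qed.

Lemma op_invertibleZ (c : R[i]) T :
  c != 0 -> op_invertible (c *: T) -> op_invertible T.
Proof.
move=> c0 [S [TS ST]]; exists (c *: S); split.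
  by rewrite -TS; apply: boundedOpP => x; rewrite !opE op_linZ.
by rewrite -ST; apply: boundedOpP => x; rewrite !opE op_linZ.
Qed.

(** Neumann series. The bound (1 - r)|y| <= |(1 - N) y| turns the telescoping
    identity (1 - N)(1 + N + ... + N^(n-1)) = 1 - N^n into the Cauchy property
    of the partial sums. *)
Lemma neumann_invertible (N : 'B(H)) (r : R) : 0 <= r < 1 ->
  (forall x, rnorm (N x) <= r * rnorm x) -> op_invertible (1 - N).
Proof.
move=> /andP[r0 r1] Nr.
have NX n x : rnorm ((N ^+ n) x) <= r ^+ n * rnorm x.
  elim: n => [|n IH]; first by rewrite !expr0 mul1r.
  rewrite !exprS opE -mulrA; apply: le_trans (Nr _) _.
  by rewrite ler_wpM2l.
have below y : (1 - r) * rnorm y <= rnorm ((1 - N) y).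
  have : rnorm y <= rnorm ((1 - N) y) + rnorm (N y).
    by rewrite -{1}(subrK (N y) y) rnormD.
  have := Nr y; lra.
have r1' : 0 < 1 - r by rewrite subr_gt0.
have small e : 0 < e -> exists n, forall k, (n <= k)%N -> r ^+ k <= e.
  move=> e0; have /cvgrPdist_le/(_ _ e0)[n _ hn] : r ^+ k @[k --> \oo] --> (0 : R).
    by apply: cvg_expr; rewrite ger0_norm.
  by exists n => k /hn /=; rewrite sub0r normrN ger0_norm// exprn_ge0.
pose S_ n := \sum_(k < n) N ^+ k.
have S_l n : (1 - N) * S_ n = 1 - N ^+ n.
  elim: n => [|n IH]; first by rewrite /S_ big_ord0 mulr0 expr0 subrr.
  rewrite /S_ big_ord_recr /= mulrDr -/(S_ n) IH mulrBl mul1r -exprS.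
  by rewrite addrA subrK.
have [|S hS] := @op_complete S_.
  move=> e e0; have [|n0 hn0] := small (e * (1 - r) / 2).
    by rewrite divr_gt0// mulr_gt0.
  exists n0 => n k /hn0 hn /hn0 hk x.
  rewrite -(ler_pM2l r1'); apply: le_trans (below _) _.
  have -> : (1 - N) (S_ n x - S_ k x) = (N ^+ k) x - (N ^+ n) x.
    rewrite op_linB -!op_mulE !S_l !opE opprB addrC addrA subrK.
    by rewrite addrC.
  apply: le_trans (rnormD _ _) _; rewrite rnormN.
  have := NX n x; have := NX k x; have := rnorm_ge0 x; nra.
have S_r x : (1 - N) (S x) = x.
  apply/eqP; rewrite -subr_eq0; apply/eqP/rnorm_small => e e0.
  have d0 : 0 < e / (3 * (1 + rnorm x)).
    by rewrite divr_gt0// mulr_gt0// ltr_pwDl// rnorm_ge0.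
  have [n1 h1] := hS _ d0; have [n2 h2] := small _ d0.
  pose n := maxn n1 n2.
  have {}h1 := h1 n (leq_maxl _ _) x; have {}h2 := h2 n (leq_maxr _ _).
  have -> : (1 - N) (S x) - x = - (1 - N) (S_ n x - S x) - (N ^+ n) x.
    rewrite (op_linB _ (S_ n x)) -(op_mulE _ (S_ n)) S_l opprB.
    move: ((1 - N) (S x)) => b.
    by rewrite (op_addE 1) op_oppE op_1E opprB addrA addrAC addrK.
  have up y : rnorm ((1 - N) y) <= 2 * rnorm y.
    have : rnorm ((1 - N) y) <= rnorm y + rnorm (N y).
      by rewrite !opE -(rnormN (N y)) rnormD.
    have := Nr y; have := rnorm_ge0 y; nra.
  apply: le_trans (rnormD _ _) _; rewrite !rnormN.
  move: d0 h1 h2 (up (S_ n x - S x)); set d := e / _ => d0 h1 h2 {}up.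
  have {}NX : rnorm ((N ^+ n) x) <= d * rnorm x.
    by apply: le_trans (NX n x) _; rewrite ler_wpM2r// rnorm_ge0.
  have -> : e = d * (3 * (1 + rnorm x)).
    by rewrite /d divfK// gt_eqF// mulr_gt0// ltr_pwDl// rnorm_ge0.
  nra.
exists S; split; apply: boundedOpP => x; rewrite op_mulE ?S_r//.
apply/eqP; rewrite -subr_eq0; apply/eqP/rnorm_le0.
rewrite -(ler_pM2l r1') mulr0; apply: le_trans (below _) _.
by rewrite op_linB S_r subrr -(scale0r x) (rnormZ 0) normr0 mul0r.
Qed.

(** Rescaled, P has the form 1 - N with 0 <= N <= r < 1, and a positive operator
    with N <= r has norm at most r. *)
Lemma op_ge_invertible P (c : R) : 0 < c -> op_sym P ->
  (forall x, c * rdot x x <= rdot (P x) x) -> op_invertible P.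
Proof.
move=> c0 sP cP; have [K K0 PK] := rnorm_op_bound P.
have Kc : 0 < K + c by rewrite addr_gt0.
(* K + c instead of K makes r = K / (K + c) positive. *)
pose N := 1 - ((K + c)^-1)%:C *: P.
have sN : op_sym N by apply: op_symB => //; exact: op_symZ.
have r01 : 0 < K / (K + c) < 1.
  by rewrite divr_gt0// ltr_pdivrMr// mul1r ltrDl.
have /andP[r0 r1] := r01.
have NE x : rdot (N x) x = rdot x x - (K + c)^-1 * rdot (P x) x.
  by rewrite !opE !rdotE.
have N01 x : 0 <= rdot (N x) x <= K / (K + c) * rdot x x.
  have := rdot_op_bound PK x; rewrite ler_norml => /andP[_ hK].
  have xx := rdot_ge0 x; have hc := cP x.
  rewrite NE subr_ge0 [_^-1 * _]mulrC ler_pdivrMr//; apply/andP; split; first nra.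
  rewrite mulrAC ler_pdivlMr// mulrBl divfK ?gt_eqF//; nra.
apply: (@op_invertibleZ ((K + c)^-1)%:C).
  by rewrite fmorph_eq0 invr_eq0 gt_eqF.
have -> : ((K + c)^-1)%:C *: P = 1 - N by rewrite /N subKr.
apply: (@neumann_invertible _ (K / (K + c))); first by rewrite ltW.
move=> x; rewrite rnorm_leP ?(ltW r0)//.
have := pos_rnorm_le sN r0 N01 x; have /andP[_ ] := N01 x; nra.
Qed.

End Completeness.

(** * Polynomials of an operator and its spectrum *)

Section PolynomialCalculus.
Context {R : realType} {H : hilbertType R}.
Implicit Types (S T : 'B(H)) (p q : {poly R[i]}) (r s : {poly R}).

Lemma op_scaleMl (c : R[i]) S T : (c *: S) * T = c *: (S * T).
Proof. exact: boundedOpP. Qed.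

Lemma op_scaleMr (c : R[i]) S T : S * (c *: T) = c *: (S * T).
Proof. by apply: boundedOpP => x; rewrite !opE op_linZ. Qed.

(** Evaluation of complex polynomials, needed because real polynomials only
    split over the complex numbers. *)
Definition op_eval p T : 'B(H) := \sum_(i < size p) p`_i *: T ^+ i.

Lemma op_eval_wide n p T : (size p <= n)%N ->
  op_eval p T = \sum_(i < n) p`_i *: T ^+ i.
Proof.
move=> pn; rewrite /op_eval (big_ord_widen n (fun i => p`_i *: T ^+ i))//.
rewrite [RHS](bigID (fun i : 'I_n => (i < size p)%N)) /= [X in _ + X]big1 ?addr0//.
by move=> i; rewrite -leqNgt => pi; rewrite nth_default// scale0r.
Qed.

Lemma op_evalD p q T : op_eval (p + q) T = op_eval p T + op_eval q T.
Proof.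
pose n := maxn (size p) (size q).
rewrite (@op_eval_wide n (p + q)) ?size_polyD// (@op_eval_wide n p) ?leq_maxl//.
rewrite (@op_eval_wide n q) ?leq_maxr// -big_split; apply: eq_bigr => i _ /=.
by rewrite coefD scalerDl.
Qed.

Lemma op_evalZ (c : R[i]) p T : op_eval (c *: p) T = c *: op_eval p T.
Proof.
rewrite (@op_eval_wide (size p)) ?size_scale_leq// scaler_sumr.
by apply: eq_bigr => i _; rewrite coefZ scalerA.
Qed.

Lemma op_evalC c T : op_eval c%:P T = scalar_op c.
Proof.
by rewrite (@op_eval_wide 1) ?size_polyC ?leq_b1// big_ord1 coefC expr0.
Qed.

Lemma op_evalMX p T : op_eval (p * 'X) T = op_eval p T * T.
Proof.
rewrite (@op_eval_wide (size p).+1) ?size_polyMleq//; last first.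
  by rewrite (leq_trans (size_polyMleq _ _))// size_polyX addn2.
rewrite big_ord_recl coefMX /= scale0r add0r mulr_suml.
by apply: eq_bigr => i _; rewrite coefMX /= exprSr op_scaleMl.
Qed.

Lemma op_evalM p q T : op_eval (p * q) T = op_eval p T * op_eval q T.
Proof.
elim/poly_ind: q => [|q c IH].
  by rewrite mulr0 op_evalC [scalar_op 0]scale0r mulr0.
rewrite mulrDr mulrA !op_evalD !op_evalMX IH mulrDr mulrA; congr (_ + _).
by rewrite mulrC mul_polyC op_evalZ op_evalC op_scaleMr mulr1.
Qed.

Lemma op_evalX T : op_eval 'X T = T.
Proof. by rewrite -['X]mul1r op_evalMX op_evalC /scalar_op scale1r mul1r. Qed.

Lemma op_evalXsubC a T : op_eval ('X - a%:P) T = T - scalar_op a.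
Proof.
by rewrite op_evalD op_evalX -polyCN op_evalC /scalar_op scaleNr.
Qed.

Lemma op_hornerE r T : op_horner r T = op_eval (map_poly (real_complex R) r) T.
Proof.
rewrite /op_horner /op_eval size_map_poly.
by apply: eq_bigr => i _; rewrite coef_map.
Qed.

Lemma op_hornerD r s T : op_horner (r + s) T = op_horner r T + op_horner s T.
Proof. by rewrite !op_hornerE rmorphD op_evalD. Qed.

Lemma op_hornerM r s T : op_horner (r * s) T = op_horner r T * op_horner s T.
Proof. by rewrite !op_hornerE rmorphM op_evalM. Qed.

Lemma op_hornerC a T : op_horner a%:P T = scalar_op a%:C.
Proof. by rewrite !op_hornerE map_polyC op_evalC. Qed.

Lemma op_hornerX T : op_horner 'X T = T.
Proof. by rewrite !op_hornerE map_polyX op_evalX. Qed.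

Lemma op_hornerZ a r T : op_horner (a *: r) T = a%:C *: op_horner r T.
Proof. by rewrite !op_hornerE map_polyZ op_evalZ. Qed.

Lemma op_hornerN r T : op_horner (- r) T = - op_horner r T.
Proof. by rewrite -scaleN1r op_hornerZ rmorphN rmorph1 scaleN1r. Qed.

Lemma op_hornerB r s T : op_horner (r - s) T = op_horner r T - op_horner s T.
Proof. by rewrite op_hornerD op_hornerN. Qed.

Lemma op_horner_comp r s T :
  op_horner (r \Po s) T = op_horner r (op_horner s T).
Proof.
elim/poly_ind: r => [|r c IH]; first by rewrite comp_poly0 -!polyC0 !op_hornerC.
rewrite comp_polyD comp_polyM comp_polyX comp_polyC !op_hornerD !op_hornerM.
by rewrite IH !op_hornerC op_hornerX.
Qed.

Lemma op_sym_horner r T : op_sym T -> op_sym (op_horner r T).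
Proof.
move=> sT; rewrite /op_horner; elim/big_rec: _ => [x y|i S _ sS].
  by rewrite !opE !rdotE.
by apply: op_symD => //; apply/op_symZ/op_symX.
Qed.

End PolynomialCalculus.

Section Spectrum.
Context {R : realType} {H : hilbertType R}.
Implicit Types (S T : 'B(H)) (r : {poly R}) (x : H).

Lemma not_spectrum T l : ~ spectrum T l <-> op_invertible (T - scalar_op l).
Proof. by rewrite /spectrum /= notK. Qed.

Lemma spectrum_ge T (m t : R) : op_sym T ->
  (forall x, m * rdot x x <= rdot (T x) x) -> spectrum T t%:C -> m <= t.
Proof.
move=> sT mT; apply: contraPT; rewrite -ltNge => tm; apply/not_spectrum.
apply: (@op_ge_invertible _ _ _ (m - t)); first by rewrite subr_gt0.
  exact/op_symB/op_sym_scalar.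
by move=> x; rewrite !opE !rdotE; have := mT x; lra.
Qed.

Lemma spectrum_le T (M t : R) : op_sym T ->
  (forall x, rdot (T x) x <= M * rdot x x) -> spectrum T t%:C -> t <= M.
Proof.
move=> sT mT; apply: contraPT; rewrite -ltNge => tm; apply/not_spectrum.
apply: (@op_invertibleZ _ _ (-1)%:C); first by rewrite fmorph_eq0 oppr_eq0 oner_eq0.
apply: (@op_ge_invertible _ _ _ (t - M)); first by rewrite subr_gt0.
  exact/op_symZ/op_symB/op_sym_scalar.
by move=> x; rewrite !opE !rdotE; have := mT x; lra.
Qed.

(** The spectrum of a symmetric operator is real: for a = b + ic with c <> 0,
    (T - a)(T - a^* ) = (T - b)^2 + c^2 is bounded below by c^2. *)
Lemma nonreal_invertible T (a : R[i]) : op_sym T -> complex.Im a != 0 ->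
  op_invertible (T - scalar_op a).
Proof.
case: a => b c sT /= c0.
pose a := b +i* c; pose a' := b -i* c.
apply: (@op_invertible_comm _ _ _ (T - scalar_op a')).
  by rewrite -!op_evalXsubC -!op_evalM mulrC.
have -> : (T - scalar_op a) * (T - scalar_op a') =
    op_horner (('X - b%:P) ^+ 2 + (c ^+ 2)%:P) T.
  rewrite -!op_evalXsubC -!op_evalM op_hornerE; congr op_eval.
  rewrite rmorphD rmorphXn rmorphB /= map_polyX !map_polyC /=.
  have -> : a = b%:C + c%:C * 'i%C 
    by apply/eqP; rewrite eq_complex /=; apply/andP; split; apply/eqP; lra.
  have -> : a' = b%:C - c%:C * 'i%C 
    by apply/eqP; rewrite eq_complex /=; apply/andP; split; apply/eqP; lra.
  have -> : (c ^+ 2)%:C = - (c%:C * 'i%C) ^+ 2.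
    by rewrite exprMn sqr_i mulrN1 opprK rmorphXn.
  move: (c%:C * 'i%C) => w.
  rewrite polyCN polyCD polyCB [w ^+ 2]expr2 polyCM; ring.
apply: (@op_ge_invertible _ _ _ (c ^+ 2)); first by rewrite exprn_even_gt0.
  exact: op_sym_horner.
move=> x; rewrite op_hornerD op_hornerC expr2 op_hornerM !opE !rdotE.
have sS : op_sym (op_horner ('X - b%:P) T) by exact: op_sym_horner.
by rewrite sS lerDr rdot_ge0.
Qed.

(** Spectral mapping, in the form needed here: over the complex numbers r
    splits into linear factors X - z, and each T - z is invertible, for z real
    because z is a root of r, and otherwise because the spectrum is real. *)
Lemma op_horner_invertible r T : op_sym T -> r != 0 ->
  (forall t : R, spectrum T t%:C -> r.[t] != 0) -> op_invertible (op_horner r T).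
Proof.
move=> sT r0 rT; rewrite op_hornerE; set p := map_poly _ r.
have p0 : p != 0 by rewrite map_poly_eq0.
have [zs zsE] := closed_field_poly_normal p.
have zs_root z : z \in zs -> root p z.
  by move=> zzs; rewrite zsE rootZ ?lead_coef_eq0// root_prod_XsubC.
have : {in zs, forall z, op_invertible (T - scalar_op z)}.
  move=> z /zs_root pz; have [Iz|] := eqVneq (complex.Im z) 0; last first.
    exact: nonreal_invertible.
  have zE : z = (complex.Re z)%:C by case: (z) Iz => u v /= ->.
  apply/not_spectrum; rewrite zE => /rT /negP; apply.
  by move: pz; rewrite zE /root horner_map fmorph_eq0.
rewrite zsE op_evalZ => {zsE zs_root} invz.
have [S [TS ST]] : op_invertible (op_eval (\prod_(z <- zs) ('X - z%:P)) T).
  elim: zs invz => [|z zs IH] invz.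
    rewrite big_nil op_evalC /scalar_op scale1r; exact: op_invertible1.
  rewrite big_cons op_evalM op_evalXsubC; apply: op_invertibleM.
    by apply: invz; rewrite inE eqxx.
  by apply: IH => w wzs; apply: invz; rewrite inE wzs orbT.
exists ((lead_coef p)^-1 *: S).
have lp : lead_coef p != 0 by rewrite lead_coef_eq0.
by rewrite !op_scaleMl !op_scaleMr TS ST !scalerA divff// mulVf// scale1r.
Qed.

(** The infimum mu of the numerical range lies in the spectrum: if S - mu were
    invertible, |S x - mu x|^2 <= K <S x - mu x, x> would bound S - mu below by
    a positive constant. *)
Lemma negative_spectrum S x0 : op_sym S -> rdot (S x0) x0 < 0 ->
  exists2 mu : R, mu < 0 & spectrum S mu%:C.
Proof.
move=> sS Sx0.
have x0x0 : 0 < rdot x0 x0.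
  rewrite rdot_gt0; apply/eqP => x00; move: Sx0.
  by rewrite x00 rdot0r ltxx.
have [K K0 SK] := rnorm_op_bound S.
pose E := [set c : R | forall x, c * rdot x x <= rdot (S x) x].
have ubE c : E c -> c <= rdot (S x0) x0 / rdot x0 x0.
  by move=> Ec; rewrite ler_pdivlMr.
have EK : E (- K).
  move=> x; have := rdot_op_bound SK x; rewrite ler_norml => /andP[+ _]; lra.
have supE : has_sup E by split; [exists (- K)|exists (rdot (S x0) x0 / rdot x0 x0)].
pose mu := sup E.
have mu0 : mu < 0.
  apply: (@le_lt_trans _ _ (rdot (S x0) x0 / rdot x0 x0)).
    by apply: ge_sup => //; exists (- K).
  by rewrite pmulr_llt0// invr_gt0.
have Emu : E mu.
  move=> x; have [->|xn0] := eqVneq x 0; first by rewrite !rdotE mulr0.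
  rewrite -ler_pdivlMr ?rdot_gt0//; apply: ge_sup; first by exists (- K).
  by move=> c Ec; rewrite ler_pdivlMr ?rdot_gt0.
exists mu => //; apply: contrapT => /not_spectrum[V [_ VS]].
pose P := S - scalar_op mu%:C; rewrite -/P in VS.
have sP : op_sym P by exact/op_symB/op_sym_scalar.
have PE x : rdot (P x) x = rdot (S x) x - mu * rdot x x by rewrite !opE !rdotE.
have [L L0 PL] := rnorm_op_bound P.
have hP x : 0 <= rdot (P x) x <= L * rdot x x.
  have := rdot_op_bound PL x; rewrite ler_norml => /andP[_ ->].
  by rewrite PE subr_ge0 Emu.
have [k k0 Vk] := rnorm_op_bound V.
have Lk : 0 < L * k ^+ 2 by rewrite mulr_gt0// exprn_gt0.
suff : E (mu + (L * k ^+ 2)^-1).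
  move=> /(ub_le_sup supE.2); rewrite -/mu gerDl leNgt invr_gt0 Lk//.
move=> x; have := PE x; have := pos_rnorm_le sP L0 hP x.
have : rdot x x <= k ^+ 2 * rdot (P x) (P x).
  by rewrite -rnorm_leP ?(ltW k0)//; move: (Vk (P x)); rewrite -op_mulE VS.
have k20 : 0 <= k ^+ 2 by rewrite sqr_ge0.
have : (L * k ^+ 2)^-1 * (L * k ^+ 2) = 1 by rewrite mulVf ?gt_eqF.
rewrite mulrDl => h1 h2 h3 h4.
suff : (L * k ^+ 2)^-1 * rdot x x <= rdot (P x) x by lra.
by rewrite mulrC ler_pdivrMr//; nra.
Qed.

(** Positivity of the functional calculus on polynomials. A negative value of
    the form of r(T) yields mu < 0 with r(T) - mu not invertible, so that
    r - mu has a zero on the spectrum of T, unless r = mu identically; then T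
    has empty spectrum, which is impossible as soon as H is nontrivial. *)
Lemma op_horner_ge0 r T : op_sym T ->
  (forall t : R, spectrum T t%:C -> 0 <= r.[t]) ->
  forall x, 0 <= rdot (op_horner r T x) x.
Proof.
move=> sT rT x; rewrite leNgt; apply/negP => rx.
have [mu mu0 rmu] := negative_spectrum (op_sym_horner r sT) rx.
have [r_mu|r_mu] := eqVneq (r - mu%:P) 0; last first.
  suff /not_spectrum : op_invertible (op_horner r T - scalar_op mu%:C) by [].
  rewrite -(op_hornerC _ T) -op_hornerB.
  apply: op_horner_invertible => // t /rT rt.
  rewrite !hornerE subr_eq0 gt_eqF// (lt_le_trans mu0)//.
have {}r_mu : r = mu%:P by apply/eqP; rewrite -subr_eq0 r_mu.
have noT t : ~ spectrum T t%:C.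
  by move=> /rT; rewrite r_mu hornerC leNgt mu0.
have [K K0 TK] := rnorm_op_bound T.
have x0 : 0 < rdot x x.
  by rewrite rdot_gt0; apply/eqP => x0; move: rx; rewrite x0 rdot0r ltxx.
have [||nu _ nuT] := @negative_spectrum (T - scalar_op (K + 1)%:C) x.
- exact/op_symB/op_sym_scalar.
- have := rdot_op_bound TK x; rewrite ler_norml => /andP[_].
  rewrite !opE !rdotE; lra.
- have /not_spectrum := noT (K + 1 + nu).
  suff -> : T - scalar_op (K + 1 + nu)%:C =
    T - scalar_op (K + 1)%:C - scalar_op nu%:C by move/not_spectrum; apply.
  by rewrite /scalar_op rmorphD scalerDl opprD addrA.
Qed.

End Spectrum.

(** * The Weierstrass approximation theorem *)

Section Weierstrass.
Context {R : realType}.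
Implicit Types (g : R -> R) (phi psi : nat -> R) (x e : R).

(** The Bernstein polynomial of degree n of the values phi 0, ..., phi n, i.e.
    the mean of phi under the binomial law of parameters n and 'X, computed by
    conditioning on the first trial. *)
Fixpoint bernstein n phi : {poly R} :=
  if n is n'.+1 then
    'X * bernstein n' (fun k => phi k.+1) + (1 - 'X) * bernstein n' phi
  else (phi 0)%:P.

Lemma bernsteinSE n phi x : (bernstein n.+1 phi).[x] =
  x * (bernstein n (fun k => phi k.+1)).[x] + (1 - x) * (bernstein n phi).[x].
Proof. by rewrite /= !hornerE. Qed.

Lemma bernstein_le n phi psi x : 0 <= x <= 1 ->
  (forall k, (k <= n)%N -> phi k <= psi k) ->
  (bernstein n phi).[x] <= (bernstein n psi).[x].
Proof.
move=> /andP[x0 x1]; elim: n phi psi => [|n IH] phi psi h.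
  by rewrite /= !hornerC h.
rewrite !bernsteinSE lerD// ler_wpM2l ?subr_ge0//; apply: IH => k kn.
  exact: h.
by apply: h; rewrite (leq_trans kn).
Qed.

Lemma bernstein_affine n phi (a b : R) x :
  (bernstein n (fun k => a + b * phi k)).[x] = a + b * (bernstein n phi).[x].
Proof.
elim: n phi => [|n IH] phi; first by rewrite /= !hornerC.
by rewrite !bernsteinSE !IH; ring.
Qed.

Lemma bernstein_moment2 n (c x : R) :
  (bernstein n (fun k => (k%:R - c) ^+ 2)).[x] =
  n%:R * x * (1 - x) + (n%:R * x - c) ^+ 2.
Proof.
elim: n c => [|n IH] c; first by rewrite /= hornerC; ring.
rewrite bernsteinSE IH.
have -> : (fun k : nat => (k.+1%:R - c) ^+ 2) = (fun k => (k%:R - (c - 1)) ^+ 2).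
  by apply/funext => k; rewrite -natr1; ring.
by rewrite IH -natr1; ring.
Qed.

(** A quadratic modulus of continuity is what the variance bound for Bernstein
    polynomials consumes. Locally it comes from continuity for close points and
    from boundedness for distant ones; compactness makes K uniform. *)
Lemma quadratic_modulus g e : continuous g -> 0 < e ->
  exists2 K : R, 0 <= K & forall s t, 0 <= s <= 1 -> 0 <= t <= 1 ->
    `|g s - g t| <= e + K * (s - t) ^+ 2.
Proof.
move=> cg e0.
have [G gG] : exists G : R, forall t, 0 <= t <= 1 -> `|g t| <= G.
  have cng : {within `[0, 1], continuous (fun t => `|g t|)}.
    by apply: continuous_subspaceT => t; apply: cvg_norm; exact: cg.
  have [c _ hc] := EVT_max ler01 cng.
  by exists `|g c| => t t01; apply: hc; rewrite in_itv.
pose P K s := 0 <= s <= 1 -> forall t, 0 <= t <= 1 ->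
  `|g s - g t| <= e + K * (s - t) ^+ 2.
have e2 : 0 < e / 2 by rewrite divr_gt0.
have : \forall K \near +oo, `[0, 1]%classic `<=` P K.
  apply: ((compact_near_coveringP _).1 (@segment_compact R 0 1)) => s0 _.
  have /cvgrPdist_le/(_ _ e2)/nbhs_ballP[d d0 hd] := cg s0.
  have d2 : 0 < d / 2 by rewrite divr_gt0.
  exists (ball s0 (d / 2), [set K | 2 * G / (d / 2) ^+ 2 <= K]) => /=.
    by split; [exact: nbhsx_ballx|apply: nbhs_pinfty_ge; rewrite num_real].
  move=> [s K] /= [s0s GK] s01 t t01.
  rewrite /ball /= in hd s0s.
  have sqd : 0 < (d / 2) ^+ 2 by rewrite exprn_gt0.
  rewrite ler_pdivrMr// in GK.
  have G0 : 0 <= G by apply: le_trans (gG _ s01).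
  have K0 : 0 <= K by rewrite -(pmulr_lge0 _ sqd); lra.
  have [st|st] := ltP `|s - t| (d / 2).
    have h1 : `|g s0 - g s| <= e / 2 by apply: hd; lra.
    have h2 : `|g s0 - g t| <= e / 2.
      apply: hd; have -> : s0 - t = (s0 - s) + (s - t) by ring.
      by apply: le_lt_trans (ler_normD _ _) _; lra.
    have -> : g s - g t = (g s0 - g t) - (g s0 - g s) by ring.
    apply: le_trans (ler_normB _ _) _.
    have := mulr_ge0 K0 (sqr_ge0 (s - t)); lra.
  have : (d / 2) ^+ 2 <= (s - t) ^+ 2.
    by rewrite -[leRHS]real_normK ?num_real// ler_sqr// nnegrE ltW.
  have := gG s s01; have := gG t t01; have := ler_normB (g s) (g t); nra.
case=> K0 [_ hK]; pose K := Num.max K0 0 + 1.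
exists K => [|s t s01]; first by rewrite addr_ge0// le_max lexx orbT.
have KK : K0 < K.
  by rewrite ltr_pwDr// le_max lexx.
by apply: (hK _ KK s) => //; rewrite /= in_itv.
Qed.

Lemma weierstrass01 g e : continuous g -> 0 < e ->
  exists p : {poly R}, forall x, 0 <= x <= 1 -> `|p.[x] - g x| <= e.
Proof.
move=> cg e0; have e2 : 0 < e / 2 by rewrite divr_gt0.
have [K K0 gK] := quadratic_modulus cg e2.
pose n := (Num.trunc (K / (e / 2))).+1.
have n0 : 0 < n%:R :> R by rewrite ltr0n.
have Kn : K / n%:R <= e / 2.
  by rewrite ler_pdivrMr// mulrC -ler_pdivrMr// ltW// truncnS_gt.
exists (bernstein n (fun k => g (k%:R / n%:R))) => x x01.
have /andP[x0 x1] := x01.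
(* psi 1 and psi (-1) bound the values from above and below, and their
   Bernstein polynomials are explicit by the second moment. *)
pose psi c k := g x + c * (e / 2) + c * K / n%:R ^+ 2 * (k%:R - n%:R * x) ^+ 2.
have psiE c : (bernstein n (psi c)).[x] =
    g x + c * (e / 2 + K / n%:R * (x * (1 - x))).
  rewrite bernstein_affine bernstein_moment2 subrr; field.
  by rewrite gt_eqF.
have bound k : (k <= n)%N ->
    `|g (k%:R / n%:R) - g x| <= e / 2 + K / n%:R ^+ 2 * (k%:R - n%:R * x) ^+ 2.
  move=> kn; have -> : K / n%:R ^+ 2 * (k%:R - n%:R * x) ^+ 2 =
      K * (k%:R / n%:R - x) ^+ 2 by field; rewrite gt_eqF.
  by apply: gK => //; rewrite divr_ge0//= ler_pdivrMr// mul1r ler_nat.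
have up : (bernstein n (fun k => g (k%:R / n%:R))).[x] <= (bernstein n (psi 1)).[x].
  apply: bernstein_le => // k /bound; rewrite ler_norml /psi => /andP[_]; lra.
have lo : (bernstein n (psi (-1))).[x] <= (bernstein n (fun k => g (k%:R / n%:R))).[x].
  apply: bernstein_le => // k /bound; rewrite ler_norml /psi => /andP[]; lra.
have : K / n%:R * (x * (1 - x)) <= e / 2.
  have : 0 <= K / n%:R by rewrite divr_ge0.
  nra.
move: up lo; rewrite !psiE ler_norml => up lo h; apply/andP; split; lra.
Qed.

Lemma weierstrass g (a b e : R) : continuous g -> a < b -> 0 < e ->
  exists p : {poly R}, forall x, a <= x <= b -> `|p.[x] - g x| <= e.
Proof.
move=> cg ab e0; have ba : 0 < b - a by rewrite subr_gt0.
have [|p hp] := @weierstrass01 (fun s => g (a + (b - a) * s)) _ _ e0.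
  move=> s; apply: (@continuous_comp _ _ _ (fun s => a + (b - a) * s) g);
    last exact: cg.
  apply: cvgD; first exact: cvg_cst.
  by apply: cvgM; [exact: cvg_cst|exact: cvg_id].
exists (p \Po ((b - a)^-1 *: ('X - a%:P))) => x /andP[ax xb].
rewrite horner_comp !hornerE.
have -> : g x = g (a + (b - a) * ((b - a)^-1 * (x - a))).
  by rewrite mulrA divff ?gt_eqF// mul1r addrC subrK.
apply: hp; rewrite mulr_ge0 ?invr_ge0 ?(ltW ba) ?subr_ge0//=.
by rewrite mulrC ler_pdivrMr// mul1r lerD2r.
Qed.

End Weierstrass.

(** * Continuous functional calculus *)

Section FunctionalCalculus.
Context {R : realType} {H : hilbertType R}.
Implicit Types (S T U : 'B(H)) (g h : R -> R) (p q s : {poly R}) (x y : H).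

Lemma ler_all_eps (a b c : R) :
  0 <= c -> (forall e, 0 < e -> a <= b + e * c) -> a <= b.
Proof.
move=> c0 abc; apply/ler_addgt0Pr => d d0.
have c1 : 0 < c + 1 by rewrite ltr_wpDl.
apply: le_trans (abc (d / (c + 1)) _) _; first by rewrite divr_gt0.
by rewrite lerD2l mulrAC ler_pdivrMr// ler_pM2l// lerDl.
Qed.

Lemma uniform_cvgP (E : set R) (u : nat -> R -> R) g :
  {uniform E, u @ \oo --> g} <->
  forall e, 0 < e -> exists N, forall n, (N <= n)%N -> forall t, E t ->
    `|u n t - g t| < e.
Proof.
split=> [ug e e0|ug P /uniform_nbhs[V [+ VP]]].
  have [|N _ hN] := ug [set h | forall t, E t -> `|h t - g t| < e].
    apply/uniform_nbhs; exists [set ab | ball ab.1 e ab.2]; split.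
      by rewrite -entourage_ballE; exists e.
    by move=> h /= hE t /hE; rewrite /ball /= distrC.
  by exists N => n /hN.
rewrite -entourage_ballE => -[e /= e0 eV]; have [N hN] := ug e e0.
exists N => // n /= Nn; apply: VP => t Et; apply: eV => /=.
by rewrite /ball /= distrC hN.
Qed.

Lemma opnorm_set T : [set k : R | 0 <= k /\ forall x, `|T x| <= k%:C * `|x|] =
  [set k : R | 0 <= k /\ forall x, rnorm (T x) <= k * rnorm x].
Proof.
apply/seteqP; split => k /= [k0 hk]; split=> // x; move: (hk x);
  by rewrite !rnormE -rmorphM lecR.
Qed.

Lemma opnorm_ge0 T : 0 <= opnorm T.
Proof.
rewrite /opnorm opnorm_set; apply: lb_le_inf; last by move=> k [].
have [K K0 TK] := rnorm_op_bound T; exists K; split=> //; exact: ltW.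
Qed.

Lemma opnorm_le T (k : R) : 0 <= k ->
  (forall x, rnorm (T x) <= k * rnorm x) -> opnorm T <= k.
Proof.
by move=> k0 Tk; rewrite /opnorm opnorm_set; apply: ge_inf; [exists 0 => l []|].
Qed.

Lemma opnorm_lt T (k : R) : opnorm T < k -> forall x, rnorm (T x) <= k * rnorm x.
Proof.
rewrite /opnorm opnorm_set => /inf_lt[|l [l0 Tl] lk x].
  have [K K0 TK] := rnorm_op_bound T; exists K; split=> //; exact: ltW.
by apply: le_trans (Tl x) _; rewrite ler_wpM2r ?rnorm_ge0// ltW.
Qed.

(** The isometric bound of the polynomial calculus, from the positivity of
    e^2 - q^2 on the spectrum. *)
Lemma rnorm_horner_le q T (e : R) : op_sym T -> 0 <= e ->
  (forall t : R, spectrum T t%:C -> `|q.[t]| <= e) ->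
  forall x, rnorm (op_horner q T x) <= e * rnorm x.
Proof.
move=> sT e0 qe x; rewrite rnorm_leP//.
have := @op_horner_ge0 _ _ ((e ^+ 2)%:P - q ^+ 2) _ sT _ x.
rewrite op_hornerB op_hornerC expr2 op_hornerM !opE !rdotE.
rewrite (op_sym_horner q sT) subr_ge0; apply=> t /qe.
by rewrite !hornerE subr_ge0 -(real_normK (num_real q.[t])) ler_sqr ?nnegrE.
Qed.

(** What the order statements below use of g(T): symmetry and approximation of
    the quadratic form by polynomials close to g on the spectrum. Unlike the
    functional calculus, it visibly passes to sums and compositions. *)
Definition cfc_approx g T S := op_sym S /\
  forall e : R, 0 < e -> exists p : {poly R},
    (forall t : R, spectrum T t%:C -> `|p.[t] - g t| <= e) /\
    (forall x, `|rdot (op_horner p T x - S x) x| <= e * rdot x x).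

Lemma is_cfc_approx g T S : op_sym T -> is_cfc g T S -> cfc_approx g T S.
Proof.
move=> sT [p [/uniform_cvgP pg /cvgrPdist_lt pS]].
have pe (e : R) : 0 < e -> exists q : {poly R},
    (forall t : R, spectrum T t%:C -> `|q.[t] - g t| <= e) /\
    (forall x, rnorm ((op_horner q T - S) x) <= e * rnorm x).
  move=> e0; have [N1 h1] := pg e e0; have [N2 _ h2] := pS e e0.
  exists (p (maxn N1 N2)); split=> [t Tt|].
    by apply/ltW/h1 => //; exact: leq_maxl.
  apply: opnorm_lt; have := h2 _ (leq_maxr N1 N2) => /=.
  by rewrite sub0r normrN ger0_norm ?opnorm_ge0.
split=> [x y|e /pe[q [qg qS]]]; last first.
  by exists q; split=> // x; exact: (rdot_op_bound qS).
apply/eqP; rewrite -subr_eq0 -normr_le0.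
apply: (@ler_all_eps _ _ (2 * (rnorm x * rnorm y))).
  by rewrite mulr_ge0// mulr_ge0 ?rnorm_ge0.
move=> e /pe[q [_ qS]]; rewrite add0r.
have -> : rdot (S x) y - rdot x (S y) =
    rdot x ((op_horner q T - S) y) - rdot ((op_horner q T - S) x) y.
  by rewrite !opE !rdotE (op_sym_horner q sT); ring.
apply: le_trans (ler_normB _ _) _.
have := CauchySchwarz_rdot x ((op_horner q T - S) y).
have := CauchySchwarz_rdot ((op_horner q T - S) x) y.
have := ler_wpM2l (rnorm_ge0 x) (qS y); have := ler_wpM2r (rnorm_ge0 y) (qS x).
lra.
Qed.

(** Weierstrass approximants of g on [a, b], evaluated at T, are Cauchy by the
    norm bound. The function h expresses continuity of g on [a, b] only, which
    is all that holds for superquadratic functions and their beta. *)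
Lemma is_cfc_exists g h T (a b : R) : op_sym T -> a < b ->
  (forall x, a * rdot x x <= rdot (T x) x <= b * rdot x x) ->
  continuous h -> (forall t, a <= t <= b -> g t = h t) ->
  exists S, is_cfc g T S.
Proof.
move=> sT ab Tab ch gh.
have specT t : spectrum T t%:C -> a <= t <= b.
  move=> Tt; apply/andP; split.
    by apply: (spectrum_ge sT) Tt => x; have /andP[] := Tab x.
  by apply: (spectrum_le sT) Tt => x; have /andP[] := Tab x.
have /choice[p hp] n : exists p : {poly R},
    forall t, a <= t <= b -> `|p.[t] - g t| <= (n.+1%:R : R)^-1.
  have [|q hq] := @weierstrass _ h a b (n.+1%:R)^-1 ch ab.
    by rewrite invr_gt0.
  by exists q => t tab; rewrite gh// hq.
have small (e : R) : 0 < e -> exists N, forall n, (N <= n)%N -> (n.+1%:R : R)^-1 < e.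
  move=> e0; have [N _ hN] := near_infty_natSinv_lt (PosNum e0).
  by exists N => n /hN.
have [|S hS] := @op_complete _ _ (fun n => op_horner (p n) T).
  move=> e e0; have [|N hN] := small (e / 2); first by rewrite divr_gt0.
  exists N => n k Nn Nk x; rewrite -op_oppE -op_addE -op_hornerB.
  apply: rnorm_horner_le; rewrite ?(ltW e0)// => t /specT tab.
  have -> : (p n - p k).[t] = ((p n).[t] - g t) - ((p k).[t] - g t).
    by rewrite !hornerE; ring.
  apply: le_trans (ler_normB _ _) _.
  have := le_trans (hp n t tab) (ltW (hN n Nn)).
  have := le_trans (hp k t tab) (ltW (hN k Nk)); lra.
exists S, p; split.
  apply/uniform_cvgP => e e0; have [N hN] := small e e0.
  exists N => n /hN ne t /specT tab; exact: le_lt_trans (hp n t tab) ne.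
apply/cvgrPdist_le => e e0; have [N hN] := hS e e0.
exists N => // n /= Nn; rewrite sub0r normrN ger0_norm ?opnorm_ge0//.
by apply: opnorm_le; [exact: ltW|exact: hN].
Qed.

Lemma cfc_approx_cfc g h T (a b : R) : op_sym T -> a < b ->
  (forall x, a * rdot x x <= rdot (T x) x <= b * rdot x x) ->
  continuous h -> (forall t, a <= t <= b -> g t = h t) ->
  cfc_approx g T (cfc g T).
Proof.
move=> sT ab Tab ch gh; apply: is_cfc_approx => //.
have [S gS] := is_cfc_exists sT ab Tab ch gh.
exact: (@xgetPex _ 0 [set S | is_cfc g T S]) (ex_intro _ S gS).
Qed.

Lemma cfc_approxD g h T S U : cfc_approx g T S -> cfc_approx h T U ->
  cfc_approx (fun t => g t + h t) T (S + U).
Proof.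
move=> [sS gS] [sU hU]; split=> [|e e0]; first exact: op_symD.
have e2 : 0 < e / 2 by rewrite divr_gt0.
have [p [pg pS]] := gS _ e2; have [q [qh qU]] := hU _ e2.
exists (p + q); split=> [t Tt|x].
  have := pg t Tt; have := qh t Tt; rewrite !hornerE !ler_norml; lra.
have := pS x; have := qU x; rewrite op_hornerD !opE !rdotE !ler_norml; lra.
Qed.

Lemma cfc_approxN g T S : cfc_approx g T S -> cfc_approx (fun t => - g t) T (- S).
Proof.
move=> [sS gS]; split=> [|e e0]; first exact: op_symN.
have [p [pg pS]] := gS _ e0.
exists (- p); split=> [t Tt|x].
  have := pg t Tt; rewrite !hornerE !ler_norml; lra.
have := pS x; rewrite op_hornerN !opE !rdotE !ler_norml; lra.
Qed.

Lemma cfc_approxB g h T S U : cfc_approx g T S -> cfc_approx h T U ->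
  cfc_approx (fun t => g t - h t) T (S - U).
Proof. by move=> gS hU; apply: cfc_approxD => //; exact: cfc_approxN. Qed.

Lemma spectrum_horner s T (t : R) :
  spectrum T t%:C -> spectrum (op_horner s T) s.[t]%:C.
Proof.
apply: contraPP => /not_spectrum sTt; apply/not_spectrum.
have /factor_theorem[q sq] : root (s - s.[t]%:P) t.
  by rewrite /root !hornerE subrr.
have lin : T - scalar_op t%:C = op_horner ('X - t%:P) T.
  by rewrite op_hornerB op_hornerX op_hornerC.
apply: (@op_invertible_comm _ _ _ (op_horner q T)).
  by rewrite lin -!op_hornerM mulrC.
by rewrite lin -op_hornerM mulrC -sq op_hornerB op_hornerC.
Qed.

Lemma cfc_approx_comp g s T S :
  cfc_approx g (op_horner s T) S -> cfc_approx (fun t => g s.[t]) T S.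
Proof.
move=> [sS gS]; split=> // e /gS[p [pg pS]]; exists (p \Po s); split=> [t|x].
  by move=> /(@spectrum_horner s)/pg; rewrite horner_comp.
by rewrite op_horner_comp pS.
Qed.

(** Order: g <= q on the spectrum gives g(T) <= q(T), because q + 2e - p is
    nonnegative on the spectrum for the approximants p of g. *)
Lemma cfc_approx_le g q T S : op_sym T -> cfc_approx g T S ->
  (forall t : R, spectrum T t%:C -> g t <= q.[t]) ->
  forall x, rdot (S x) x <= rdot (op_horner q T x) x.
Proof.
move=> sT [_ gS] gq x.
apply: (@ler_all_eps _ _ (2 * rdot x x)); first by rewrite mulr_ge0 ?rdot_ge0.
move=> e /gS[p [pg /(_ x)]]; rewrite rdotE ler_norml => /andP[+ _].
have := @op_horner_ge0 _ _ (q + e%:P - p) _ sT _ x.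
rewrite op_hornerB op_hornerD op_hornerC !opE !rdotE.
move=> + h; suff qpe t : spectrum T t%:C -> 0 <= (q + e%:P - p).[t].
  by move=> /(_ qpe); lra.
by move=> Tt; have := pg t Tt; have := gq t Tt; rewrite !hornerE ler_norml; lra.
Qed.

Lemma cfc_approx_ge g q T S : op_sym T -> cfc_approx g T S ->
  (forall t : R, spectrum T t%:C -> q.[t] <= g t) ->
  forall x, rdot (op_horner q T x) x <= rdot (S x) x.
Proof.
move=> sT /cfc_approxN gS gq x.
have := @cfc_approx_le _ (- q) _ _ sT gS _ x.
rewrite op_hornerN !opE !rdotE lerN2; apply=> t /gq.
by rewrite hornerN lerN2.
Qed.

End FunctionalCalculus.

(** * Superquadratic functions and positive maps *)

Section Superquadratic.
Context {R : realType}.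
Variables (f : R -> R) (m M : R).
Hypotheses (m_gt0 : 0 < m) (mM : m < M) (f_sq : superquadratic f).
Implicit Types t s : R.

Let M_gt0 : 0 < M. Proof. exact: lt_trans mM. Qed.
Let dM_gt0 : 0 < M - m. Proof. by rewrite subr_gt0. Qed.

Definition chord_slope := (f M - f m) / (M - m).
Definition chord_const := f m - chord_slope * m.

Let chord_slopeE : (M - m) * chord_slope = f M - f m.
Proof. by rewrite mulrC divfK// gt_eqF. Qed.

(** The defining inequality at t, averaged over the end points m and M with the
    weights that have barycentre t: the unknown slope cancels. *)
Lemma superquadratic_inside t : m <= t <= M ->
  f t + beta f m M t <= chord_slope * t + chord_const.
Proof.
move=> /andP[mt tM]; have [|C hC] := f_sq (x := t); first exact: le_trans (ltW m_gt0) mt.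
have := hC m (ltW m_gt0); have := hC M (ltW M_gt0).
rewrite (ler0_norm (_ : m - t <= 0)) ?subr_le0// opprB.
rewrite (ger0_norm (_ : 0 <= M - t)) ?subr_ge0// => hM hm.
rewrite -(ler_pM2l dM_gt0) /chord_const.
have -> : (M - m) * (f t + beta f m M t) =
    (M - m) * f t + (t - m) * f (M - t) + (M - t) * f (t - m).
  by rewrite /beta; field; rewrite gt_eqF.
have -> : (M - m) * (chord_slope * t + (f m - chord_slope * m)) =
    (M - m) * chord_slope * (t - m) + (M - m) * f m by ring.
rewrite chord_slopeE.
have tm : 0 <= t - m by rewrite subr_ge0.
have Mt : 0 <= M - t by rewrite subr_ge0.
have := ler_wpM2l tm hM; have := ler_wpM2l Mt hm; lra.
Qed.

(** The defining inequality at m, for the points s and M on either side of it. *)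
Lemma superquadratic_left s : 0 <= s <= m ->
  chord_slope * s + chord_const + f (M - m) / (M - m) * (m - s) <= f s - f (m - s).
Proof.
move=> /andP[s0 sm]; have [|C hC] := f_sq (x := m); first exact: ltW.
have := hC s s0; have := hC M (ltW M_gt0).
rewrite (ler0_norm (_ : s - m <= 0)) ?subr_le0// opprB (gtr0_norm dM_gt0).
move=> hM hs; rewrite -(ler_pM2l dM_gt0) /chord_const.
have -> : (M - m) * (chord_slope * s + (f m - chord_slope * m) +
      f (M - m) / (M - m) * (m - s)) =
    (M - m) * chord_slope * (s - m) + (M - m) * f m + f (M - m) * (m - s).
  by field; rewrite gt_eqF.
rewrite chord_slopeE.
have sm' : 0 <= m - s by rewrite subr_ge0.
have := ler_wpM2l sm' hM; have := ler_wpM2l (ltW dM_gt0) hs; lra.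
Qed.

(** The defining inequality at M, for the points m and s on either side of it. *)
Lemma superquadratic_right s : M <= s ->
  chord_slope * s + chord_const + f (M - m) / (M - m) * (s - M) <= f s - f (s - M).
Proof.
move=> Ms; have [|C hC] := f_sq (x := M); first exact: ltW.
have s0 : 0 <= s by exact: le_trans (ltW M_gt0) Ms.
have := hC s s0; have := hC m (ltW m_gt0).
rewrite (ger0_norm (_ : 0 <= s - M)) ?subr_ge0// distrC (gtr0_norm dM_gt0).
move=> hm hs; rewrite -(ler_pM2l dM_gt0) /chord_const.
have -> : (M - m) * (chord_slope * s + (f m - chord_slope * m) +
      f (M - m) / (M - m) * (s - M)) =
    (M - m) * chord_slope * (s - m) + (M - m) * f m + f (M - m) * (s - M).
  by field; rewrite gt_eqF.
rewrite chord_slopeE.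
have sM' : 0 <= s - M by rewrite subr_ge0.
have := ler_wpM2l sM' hm; have := ler_wpM2l (ltW dM_gt0) hs; lra.
Qed.

End Superquadratic.

(** The continuous extension to the line through which f, and beta on [m, M],
    are approximated by polynomials. *)
Lemma continuous_comp_norm (R : realType) (f : R -> R) :
  {within `[0, +oo[, continuous f} -> continuous (fun t : R => f `|t|).
Proof.
move=> /subspace_continuousP cf t; apply/cvgrPdist_le => e e0.
have t0 : `[0, +oo[%classic `|t| by rewrite /= in_itv /= normr_ge0.
have /cvgrPdist_le/(_ e e0)/nbhs_ballP[d /= d0 hd] := cf _ t0.
apply/nbhs_ballP; exists d => //= s ts; apply: hd.
  by rewrite /ball /= (le_lt_trans (ler_dist_dist _ _)).
by rewrite /= in_itv /= normr_ge0.
Qed.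

Section PositiveMaps.
Context {R : realType} {H : hilbertType R}.
Variable Phi : {linear 'B(H) -> 'B(H)}.
Hypothesis Phi_pos : forall X : 'B(H), op_pos X -> op_pos (Phi X).
Hypothesis Phi_unital : Phi 1 = 1.
Implicit Types (S T : 'B(H)) (x : H).

Lemma pos_map_scalar a : Phi (scalar_op a) = scalar_op a.
Proof. by rewrite /scalar_op linearZ /= Phi_unital. Qed.

(** A symmetric S is the difference of the positive operators S + K and K. *)
Lemma pos_map_sym S : op_sym S -> op_sym (Phi S).
Proof.
move=> sS; have [K K0 SK] := rnorm_op_bound S.
have /Phi_pos/op_posP[] : op_pos (S + scalar_op K%:C).
  apply/op_posP; split; first exact/op_symD/op_sym_scalar.
  move=> x; have := rdot_op_bound SK x; rewrite ler_norml => /andP[+ _].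
  rewrite !opE !rdotE; lra.
rewrite linearD /= pos_map_scalar => sPhi _.
by rewrite -(addrK (scalar_op K%:C) (Phi S)); exact/op_symB/op_sym_scalar.
Qed.

Lemma pos_map_le S T : op_sym S -> op_sym T ->
  (forall x, rdot (S x) x <= rdot (T x) x) ->
  forall x, rdot (Phi S x) x <= rdot (Phi T x) x.
Proof.
move=> sS sT ST; apply/(op_leP (pos_map_sym sS) (pos_map_sym sT)).
have /(op_leP sS sT) := ST.
by rewrite /op_le => /Phi_pos; rewrite linearB.
Qed.

End PositiveMaps.

Section SuperquadraticOperators.
Context {R : realType} {H : hilbertType R}.
Variables (f : R -> R) (m M : R).
Hypotheses (m_gt0 : 0 < m) (mM : m < M) (f_sq : superquadratic f).
Hypothesis f_cont : {within `[0, +oo[, continuous f}.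
Implicit Types (T : 'B(H)) (x : H).

Let f_ext := continuous_comp_norm f_cont.
Let a := chord_slope f m M.
Let b := chord_const f m M.
Let k := f (M - m) / (M - m).

Let beta_ext : continuous (beta (fun t : R => f `|t|) m M).
Proof.
have cvg_f (u : R -> R) t : {for t, continuous u} ->
    (fun s => f `|u s|) @ t --> f `|u t|.
  move=> cu; apply: (@continuous_comp _ _ _ u (fun t => f `|t|)); first exact: cu.
  exact: f_ext.
move=> t; apply: cvgD; apply: cvgM.
- by apply: cvgMl; apply: cvgB; [exact: cvg_id|exact: cvg_cst].
- by apply: cvg_f; apply: cvgB; [exact: cvg_cst|exact: cvg_id].
- by apply: cvgMl; apply: cvgB; [exact: cvg_cst|exact: cvg_id].
- by apply: cvg_f; apply: cvgB; [exact: cvg_id|exact: cvg_cst].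
Qed.

Lemma cfc_inside T : op_sym T ->
  (forall x, m * rdot x x <= rdot (T x) x <= M * rdot x x) ->
  [/\ op_sym (cfc f T), op_sym (cfc (beta f m M) T) &
    forall x, rdot (cfc f T x) x + rdot (cfc (beta f m M) T x) x <=
      a * rdot (T x) x + b * rdot x x].
Proof.
move=> sT mTM.
have cf : cfc_approx f T (cfc f T).
  apply: (cfc_approx_cfc sT mM mTM f_ext) => t /andP[mt _].
  by rewrite ger0_norm// (le_trans (ltW m_gt0)).
have cb : cfc_approx (beta f m M) T (cfc (beta f m M) T).
  apply: (cfc_approx_cfc sT mM mTM beta_ext) => t /andP[mt tM].
  by rewrite /beta !ger0_norm ?subr_ge0.
have [[sf _] [sb _]] := (cf, cb); split=> // x.
have := @cfc_approx_le _ _ _ (a *: 'X + b%:P) _ _ sT (cfc_approxD cf cb) _ x.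
rewrite op_hornerD op_hornerZ op_hornerX op_hornerC !opE !rdotE; apply=> t Tt.
rewrite !(hornerD, hornerN, hornerZ, hornerX, hornerC).
apply: superquadratic_inside => //; apply/andP; split.
  by apply: (spectrum_ge sT) Tt => y; have /andP[] := mTM y.
by apply: (spectrum_le sT) Tt => y; have /andP[] := mTM y.
Qed.

(** f(m - T) is g(T) for g = f (m - .), so the two terms on the right are a
    single function of T. *)
Lemma cfc_left T : op_sym T ->
  (forall x, 0 <= rdot (T x) x <= m * rdot x x) ->
  [/\ op_sym (cfc f T), op_sym (cfc f (scalar_op m%:C - T)) &
    forall x, a * rdot (T x) x + b * rdot x x + k * (m * rdot x x - rdot (T x) x) <=
      rdot (cfc f T x) x - rdot (cfc f (scalar_op m%:C - T) x) x].
Proof.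
move=> sT T0m.
have f_norm t : 0 <= t <= m -> f t = f `|t|.
  by move=> /andP[t0 _]; rewrite ger0_norm.
have cf : cfc_approx f T (cfc f T).
  by apply: (cfc_approx_cfc sT m_gt0 _ f_ext f_norm) => x; rewrite mul0r.
have reflE : scalar_op m%:C - T = op_horner (m%:P - 'X) T.
  by rewrite op_hornerB op_hornerX op_hornerC.
have cr : cfc_approx f (scalar_op m%:C - T) (cfc f (scalar_op m%:C - T)).
  apply: (cfc_approx_cfc _ m_gt0 _ f_ext f_norm); first exact/op_symB/sT/op_sym_scalar.
  by move=> x; have /andP[] := T0m x; rewrite !opE !rdotE; lra.
have [[sf _] [sr _]] := (cf, cr); split=> // x.
have {}cr := cfc_approx_comp (eq_ind _ (fun S => cfc_approx f S _) cr _ reflE).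
have := @cfc_approx_ge _ _ _ (a *: 'X + b%:P + k *: (m%:P - 'X)) _ _ sT
  (cfc_approxB cf cr) _ x.
rewrite !(op_hornerD, op_hornerN, op_hornerZ, op_hornerX, op_hornerC) !opE !rdotE.
apply=> t Tt; rewrite !(hornerD, hornerN, hornerZ, hornerX, hornerC).
apply: superquadratic_left => //; apply/andP; split.
  by apply: (spectrum_ge sT) Tt => y; have /andP[] := T0m y; rewrite mul0r.
by apply: (spectrum_le sT) Tt => y; have /andP[] := T0m y.
Qed.

Lemma cfc_right T : op_sym T -> (forall x, M * rdot x x <= rdot (T x) x) ->
  [/\ op_sym (cfc f T), op_sym (cfc f (T - scalar_op M%:C)) &
    forall x, a * rdot (T x) x + b * rdot x x + k * (rdot (T x) x - M * rdot x x) <=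
      rdot (cfc f T x) x - rdot (cfc f (T - scalar_op M%:C) x) x].
Proof.
move=> sT MT; have M_gt0 : 0 < M := lt_trans m_gt0 mM.
have [K K0 TK] := rnorm_op_bound T.
have {}TK x : rdot (T x) x <= K * rdot x x.
  by have := rdot_op_bound TK x; rewrite ler_norml => /andP[].
have f_norm t : 0 <= t <= K -> f t = f `|t|.
  by move=> /andP[t0 _]; rewrite ger0_norm.
have M_ge0 x : 0 <= M * rdot x x by rewrite mulr_ge0 ?rdot_ge0// ltW.
have cf : cfc_approx f T (cfc f T).
  apply: (cfc_approx_cfc sT K0 _ f_ext f_norm) => x.
  by rewrite mul0r TK (le_trans _ (MT x)).
have shiftE : T - scalar_op M%:C = op_horner ('X - M%:P) T.
  by rewrite op_hornerB op_hornerX op_hornerC.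
have cr : cfc_approx f (T - scalar_op M%:C) (cfc f (T - scalar_op M%:C)).
  apply: (cfc_approx_cfc _ K0 _ f_ext f_norm); first exact/op_symB/op_sym_scalar.
  by move=> x; have := TK x; have := MT x; have := M_ge0 x; rewrite !opE !rdotE; lra.
have [[sf _] [sr _]] := (cf, cr); split=> // x.
have {}cr := cfc_approx_comp (eq_ind _ (fun S => cfc_approx f S _) cr _ shiftE).
have := @cfc_approx_ge _ _ _ (a *: 'X + b%:P + k *: ('X - M%:P)) _ _ sT
  (cfc_approxB cf cr) _ x.
rewrite !(op_hornerD, op_hornerN, op_hornerZ, op_hornerX, op_hornerC) !opE !rdotE.
apply=> t Tt; rewrite !(hornerD, hornerN, hornerZ, hornerX, hornerC).
apply: superquadratic_right => //.
exact: (spectrum_ge sT MT).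
Qed.

End SuperquadraticOperators.

(** * The inequality *)

Unset Implicit Arguments.
Set Strict Implicit.

Theorem theorem2p7 (R : realType) (H : hilbertType R)
    (f : R -> R)
    (f_cont : {within `[0, +oo[, continuous f})
    (f_sq : superquadratic f)
    (A B C D : 'B(H))
    (A_pos : op_pos A) (B_pos : op_pos B) (C_pos : op_pos C) (D_pos : op_pos D)
    (ADBC : A + D = B + C)
    (m M : R) (m_gt0 : 0 < m) (mM : m < M)
    (A_ge0 : 0 <=o A) (A_le : A <=o scalar_op m%:C) (B_ge : scalar_op m%:C <=o B)
    (BC : B <=o C) (C_le : C <=o scalar_op M%:C) (D_ge : scalar_op M%:C <=o D)
    (Phi : {linear 'B(H) -> 'B(H)})
    (Phi_pos : forall X : 'B(H), op_pos X -> op_pos (Phi X))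
    (Phi_unital : Phi 1 = 1) :
  cfc f (Phi B) + cfc f (Phi C)
    + cfc (beta f m M) (Phi B) + cfc (beta f m M) (Phi C)
  <=o
  Phi (cfc f A) + Phi (cfc f D)
    - Phi (cfc f (scalar_op m%:C - A)) - Phi (cfc f (D - scalar_op M%:C))
    + (f (M - m) / (M - m))%:C *: (Phi (A - D) + scalar_op (M - m)%:C).
Proof.
have /op_posP[sA A0] := A_pos; have /op_posP[sB _] := B_pos.
have /op_posP[sC _] := C_pos; have /op_posP[sD _] := D_pos.
have sc a : op_sym (scalar_op a%:C : 'B(H)) by exact: op_sym_scalar.
have scE (a : R) (x : H) : rdot (scalar_op a%:C x) x = a * rdot x x.
  by rewrite opE rdotZl.
have Am x : rdot (A x) x <= m * rdot x x.
  by rewrite -scE; move: x; apply/(op_leP sA (sc m)).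
have mB x : m * rdot x x <= rdot (B x) x.
  by rewrite -scE; move: x; apply/(op_leP (sc m) sB).
have BC' x : rdot (B x) x <= rdot (C x) x by move: x; apply/(op_leP sB sC).
have CM x : rdot (C x) x <= M * rdot x x.
  by rewrite -scE; move: x; apply/(op_leP sC (sc M)).
have MD x : M * rdot x x <= rdot (D x) x.
  by rewrite -scE; move: x; apply/(op_leP (sc M) sD).
have Phi_sym T := @pos_map_sym _ _ _ Phi_pos Phi_unital T.
have Phi_le S T := @pos_map_le _ _ _ Phi_pos Phi_unital S T.
have Phi_scalar c : Phi (scalar_op c) = scalar_op c by exact: pos_map_scalar.
have Phi_between T : op_sym T ->
    (forall x, m * rdot x x <= rdot (T x) x <= M * rdot x x) ->
    forall x, m * rdot x x <= rdot (Phi T x) x <= M * rdot x x.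
  move=> sT mTM x; apply/andP; split.
    rewrite -scE -[scalar_op _]Phi_scalar; apply: Phi_le => // y.
    by rewrite scE; have /andP[] := mTM y.
  rewrite -scE -[scalar_op _]Phi_scalar; apply: Phi_le => // y.
  by rewrite scE; have /andP[] := mTM y.
have mBM x : m * rdot x x <= rdot (B x) x <= M * rdot x x.
  by rewrite mB (le_trans (BC' x)).
have mCM x : m * rdot x x <= rdot (C x) x <= M * rdot x x.
  by rewrite CM (le_trans _ (BC' x)).
have [sfB sbB leB] :=
  cfc_inside m_gt0 mM f_sq f_cont (Phi_sym _ sB) (Phi_between _ sB mBM).
have [sfC sbC leC] :=
  cfc_inside m_gt0 mM f_sq f_cont (Phi_sym _ sC) (Phi_between _ sC mCM).
have A0m x : 0 <= rdot (A x) x <= m * rdot x x by rewrite A0 Am.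
have [sfA sfA' geA] := cfc_left m_gt0 mM f_sq f_cont sA A0m.
have [sfD sfD' geD] := cfc_right m_gt0 mM f_sq f_cont sD MD.
set a := chord_slope f m M in leB leC geA geD.
set b := chord_const f m M in leB leC geA geD.
set k := f (M - m) / (M - m) in geA geD *.
(* The values of the functional calculus enter the rest of the proof only
   through the bounds just obtained, so they are generalized. *)
move: sfB sbB leB sfC sbC leC sfA sfA' geA sfD sfD' geD.
move: (cfc f A) (cfc f (scalar_op m%:C - A)) (cfc f D) (cfc f (D - scalar_op M%:C)).
move: (cfc f (Phi B)) (cfc (beta f m M) (Phi B)).
move: (cfc f (Phi C)) (cfc (beta f m M) (Phi C)).
move=> fC bC fB bB fA fA' fD fD' sfB sbB leB sfC sbC leC sfA sfA' geA sfD sfD' geD.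
have PhiA x :
    rdot (Phi (a%:C *: A + scalar_op b%:C + k%:C *: (scalar_op m%:C - A)) x) x
    <= rdot (Phi (fA - fA') x) x.
  apply: Phi_le => [||y]; last by have := geA y; rewrite !opE !rdotE.
    by apply: op_symD; [apply: op_symD => //; exact: op_symZ|apply/op_symZ/op_symB].
  exact: op_symB.
have PhiD x :
    rdot (Phi (a%:C *: D + scalar_op b%:C + k%:C *: (D - scalar_op M%:C)) x) x
    <= rdot (Phi (fD - fD') x) x.
  apply: Phi_le => [||y]; last by have := geD y; rewrite !opE !rdotE.
    by apply: op_symD; [apply: op_symD => //; exact: op_symZ|apply/op_symZ/op_symB].
  exact: op_symB.
have PhiABCD x :
  rdot (Phi A x) x + rdot (Phi D x) x = rdot (Phi B x) x + rdot (Phi C x) x.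
  by rewrite -!rdotDl -!op_addE -!linearD ADBC.
apply/op_leP.
- by do !apply: op_symD.
- apply: op_symD; last by apply/op_symZ/op_symD => //; exact/Phi_sym/op_symB.
  apply: op_symB; last exact: Phi_sym.
  apply: op_symB; last exact: Phi_sym.
  by apply: op_symD; exact: Phi_sym.
move=> x; have := PhiA x; have := PhiD x; have := congr1 ( *%R a) (PhiABCD x).
have := leB x; have := leC x.
rewrite /scalar_op !(linearD Phi, linearN Phi, linearZ_LR Phi) Phi_unital.
by rewrite !opE !rdotE; lra.
Qed.
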